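(* Suppose that for every integer $c\ge 0$, there exist integers $K,k\ge 1$ such that every tournament with domination number at least $K$ contains a subtournament on at most $k$ vertices having domination number at least $c$. Then for every integer $t\ge 1$, there exists $K$ such that every $\mathcal{T}_t$-free tournament has domination number at most $K$.
   Context: All tournaments are finite. The domination number of a tournament $T$ is the size of the smallest set $X\subseteq V(T)$ such that every vertex in $V(T)\setminus X$ is adjacent from a vertex in $X$ (i.e. is the head of an edge with tail in $X$). A tournament is $H$-free if none of its subtournaments is isomorphic to $H$. For tournaments $H_1,H_2,H_3$, $\Delta(H_1,H_2,H_3)$ denotes the tournament $T$ with vertex set the disjoint union of three sets $A_1,A_2,A_3$, where $T[A_i]$ is isomorphic to $H_i$ for $i=1,2,3$, all edges between $A_1$ and $A_2$ are directed from $A_1$ to $A_2$, all edges between $A_2$ and $A_3$ are directed from $A_2$ to $A_3$, and all edges between $A_3$ and $A_1$ are directed from $A_3$ to $A_1$. Let $\mathcal{T}_1$ be the tournament with one vertex, and for $t>1$ let $\mathcal{T}_t=\Delta(\mathcal{T}_{t-1},\mathcal{T}_{t-1},\mathcal{T}_{t-1})$. *)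

(* Defs.v *)
From mathcomp Require Import all_boot.

Set Implicit Arguments.
Unset Strict Implicit.
Unset Printing Implicit Defensive.

Record tournament := Tournament {
  vertex :> finType;
  arc : rel vertex;
  arc_irr : irreflexive arc;
  (* exactly one of [arc x y], [arc y x] holds for distinct x, y *)
  arc_tour : forall x y : vertex, x != y -> arc x y (+) arc y x
}.

Definition isomorphic (T H : tournament) : Prop :=
  exists f : T -> H,
    bijective f /\ forall x y : T, arc (f x) (f y) = arc x y.

Section Induced.

Variables (T : tournament) (A : {set T}).

Definition induced_arc : rel {x : T | x \in A} :=
  fun x y => arc (val x) (val y).

Lemma induced_arc_irr : irreflexive induced_arc.
Proof. by move=> x; apply: arc_irr. Qed.

Lemma induced_arc_tour x y : x != y -> induced_arc x y (+) induced_arc y x.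
Proof. by move=> neq_xy; apply: arc_tour; rewrite (inj_eq val_inj). Qed.

(* T[A] *)
Definition induced : tournament := Tournament induced_arc_irr induced_arc_tour.

End Induced.

Definition free (H T : tournament) : Prop :=
  forall A : {set T}, ~ isomorphic (induced A) H.

Definition dominating (T : tournament) (X : {set T}) : bool :=
  [forall y in ~: X, [exists x in X, arc x y]].

(* The full vertex set is dominating, so the minimum is over a nonempty
   family (see [dominatingT]). *)
Definition domination_number (T : tournament) : nat :=
  #|[arg min_(X < [set: T] | dominating X) #|X|]|.

Lemma dominatingT (T : tournament) : dominating [set: T].
Proof. by apply/forall_inP => y; rewrite setCT inE. Qed.

Section Delta.

Variables H1 H2 H3 : tournament.

Definition Delta_arc : rel (H1 + H2 + H3)%type := fun u v =>
  match u, v with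
  | inl (inl x), inl (inl y) => arc x y
  | inl (inr x), inl (inr y) => arc x y
  | inr x, inr y => arc x y
  | inl (inl _), inl (inr _) => true
  | inl (inr _), inr _ => true
  | inr _, inl (inl _) => true
  | _, _ => false
  end.

Lemma Delta_arc_irr : irreflexive Delta_arc.
Proof. by move=> [[x|x]|x] /=; apply: arc_irr. Qed.

Lemma Delta_arc_tour u v : u != v -> Delta_arc u v (+) Delta_arc v u.
Proof. by case: u v => [[x|x]|x] [[y|y]|y] //= neq_xy; apply: arc_tour. Qed.

Definition Delta : tournament := Tournament Delta_arc_irr Delta_arc_tour.

End Delta.

Lemma unit_arc_irr : irreflexive (fun _ _ : unit => false).
Proof. by []. Qed.

Lemma unit_arc_tour (x y : unit) : x != y -> false (+) false.
Proof. by case: x y => [] []. Qed.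

Definition one_vertex : tournament := Tournament unit_arc_irr unit_arc_tour.

(* Meaningful for t >= 1; the value at 0 is a dummy. *)
Fixpoint calT (t : nat) : tournament :=
  match t with
  | 0 => one_vertex
  | t'.+1 =>
      match t' with
      | 0 => one_vertex
      | _.+1 => Delta (calT t') (calT t') (calT t')
      end
  end.

(* Main.v *)
(** By induction on t, sets of large domination number contain T_(t-1), so it
is enough to find heavy sets A, B, C with A => B => C => A, where => means that
all edges go in that direction.  Local-to-global and pigeonhole show that any
two sufficiently heavy sets have heavy subsets X, Y with X => Y or Y => X; say
that A beats B when such X in A and Y in B with X => Y exist.  If T has large
domination number, then each heavy set B of bounded size has a heavy set s(B)
of the same bounded size with s(B) => B.  If there is no heavy triangle, then A
beats s(B) and B beats s(A) cannot both hold: they give a heavy 4-cycle, which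
has a heavy chord.  On a nonempty finite family permuted by s, the number of
pairs (A, B) such that A beats s(B) equals the number of those such that A beats
B; the former is at most n(n-1)/2 and the latter at least n(n+1)/2. *)

From mathcomp Require Import all_boot.
Require Import Defs.

Set Implicit Arguments.
Unset Strict Implicit.
Unset Printing Implicit Defensive.

(** * A counting argument for a relation shifted by a self-map *)

Lemma total_shift_empty (I : finType) (P : rel I) (s : I -> I) (E : {set I}) :
    {in E, forall x, s x \in E} ->
    {in E &, forall x y, P x y || P y x} ->
    {in E &, forall x y, ~~ (P x (s y) && P y (s x))} ->
  E = set0.
Proof.
move=> sE Ptot Pshift; apply/eqP; apply: contraT => E0.
(* A smallest nonempty [s]-stable set is permuted by [s], since its image is again such a set. *)
pose inv (C : {set I}) := [&& C != set0, C \subset E & s @: C \subset C].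
have invE : inv E.
  by rewrite /inv E0 subxx; apply/subsetP => _ /imsetP[x xE ->]; apply: sE.
case: (@arg_minnP _ E inv (fun C => #|C|) invE) => C /and3P[C0 CE sC] Cmin.
have CsC : s @: C = C.
  apply/eqP; rewrite eqEcard sC; apply: Cmin; apply/and3P; split.
  - by rewrite imset_eq0.
  - exact: subset_trans CE.
  - exact: imsetS.
have s_inj : {in C &, injective s} by apply/imset_injP; rewrite CsC.
pose sumP (f : I -> I) := \sum_(x in C) \sum_(y in C) nat_of_bool (P x (f y)).
have sumPs : sumP s = sumP id.
  apply: eq_bigr => x _; rewrite -{2}CsC.
  by rewrite [RHS](big_imset (fun y => nat_of_bool (P x y))).
have double f : sumP f + sumP f =
    \sum_(x in C) \sum_(y in C) (P x (f y) + P y (f x)).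
  rewrite {2}/sumP exchange_big -big_split; apply: eq_bigr => x _.
  by rewrite -big_split.
(* A crude bound, with diagonal pairs also counted as at most 1; it suffices because the lower bound
   exceeds it by [#|C|]. *)
have upper : sumP s + sumP s <= #|C| * #|C|.
  rewrite double -sum_nat_const leq_sum // => x xC.
  rewrite -sum1_card leq_sum // => y yC.
  have := Pshift x y (subsetP CE x xC) (subsetP CE y yC).
  by case: (P x _); case: (P y _).
have lower : #|C| * #|C|.+1 <= sumP id + sumP id.
  rewrite double -sum_nat_const leq_sum // => x xC.
  (* The diagonal term counts 2, because totality at [(x, x)] gives [P x x]; this is the source of
     the extra 1 in each row. *)
  rewrite (bigD1 x) //= -(cardsID [set x]).
  have Pxx : P x x.
    by have := Ptot x x (subsetP CE x xC) (subsetP CE x xC); rewrite orbb.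
  rewrite Pxx (_ : C :&: [set x] = [set x]) ?cards1; last first.
    by apply/setIidPr; rewrite sub1set.
  rewrite addSn add1n addSn add1n !ltnS -sum1_card.
  rewrite (eq_bigl (fun y => (y \in C) && (y != x))); last first.
    by move=> y; rewrite !inE andbC.
  apply: leq_sum => y /andP[yC _].
  have := Ptot x y (subsetP CE x xC) (subsetP CE y yC).
  by case: (P x _); case: (P y _).
have C_gt0 : 0 < #|C| by rewrite card_gt0.
move: lower; rewrite -sumPs => /leq_trans/(_ upper).
rewrite leq_mul2l ltnn orbF.
by rewrite eqn0Ngt C_gt0.
Qed.

(** * Light and heavy sets, and complete pairs of heavy sets *)

Section Light.

Variable T : tournament.
Implicit Types (D X Y Z A B C : {set T}) (d e n : nat).

Definition dominates_on D X :=
  (D \subset X) && [forall y in X :\: D, [exists x in D, arc x y]].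

(* Requiring domination of every subset makes smallness monotone, which the
   domination number itself is not. *)
Definition light n X :=
  [forall Y : {set T}, (Y \subset X) ==>
     [exists D : {set T}, dominates_on D Y && (#|D| <= n)]].

Definition complete X Y := [forall x in X, forall y in Y, arc x y].

Lemma dominates_onP D X :
  reflect (D \subset X /\
           forall y, y \in X -> y \notin D -> exists2 x, x \in D & arc x y)
          (dominates_on D X).
Proof.
apply: (iffP andP) => [[DX /forall_inP H]|[DX H]]; split=> //.
  by move=> y yX yD; apply/exists_inP; apply: H; rewrite inE yD.
by apply/forall_inP => y /setDP[yX yD]; apply/exists_inP; apply: H.
Qed.

Lemma lightP n X :
  reflect (forall Y : {set T}, Y \subset X -> exists2 D, dominates_on D Y & #|D| <= n)
          (light n X).
Proof.
apply: (iffP forall_inP) => H Y /H.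
  by case/existsP => D /andP[]; exists D.
by case=> D *; apply/existsP; exists D; apply/andP.
Qed.

Lemma heavyP n X :
  reflect (exists2 Y : {set T}, Y \subset X & forall D, dominates_on D Y -> n < #|D|)
          (~~ light n X).
Proof.
apply: (iffP idP) => [|[Y YX H]].
  rewrite negb_forall => /existsP[Y]; rewrite negb_imply => /andP[YX].
  rewrite negb_exists => /forallP H; exists Y => // D domD.
  by have := H D; rewrite domD ltnNge.
apply/negP => /lightP/(_ Y YX)[D domD].
by rewrite leqNgt H.
Qed.

Lemma completeP X Y :
  reflect {in X & Y, forall x y, arc x y} (complete X Y).
Proof.
apply: (iffP forall_inP) => [H x y xX yY|H x xX].
  by have /forall_inP := H x xX; apply.
by apply/forall_inP => y yY; apply: H.
Qed.

Lemma completeS X X' Y Y' :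
  X' \subset X -> Y' \subset Y -> complete X Y -> complete X' Y'.
Proof.
move=> /subsetP XX /subsetP YY /completeP H; apply/completeP => x y xX yY.
by apply: H; [apply: XX | apply: YY].
Qed.

Lemma arc_total (x y : T) : x != y -> arc x y || arc y x.
Proof. by move/arc_tour; case: (arc x y). Qed.

Lemma arc_asym (x y : T) : arc x y -> arc y x = false.
Proof.
move=> xy; case: (eqVneq x y) => [eq_xy|/arc_tour]; last by rewrite xy => /negbTE.
by move: xy; rewrite eq_xy arc_irr.
Qed.

Lemma lightS n X Y : X \subset Y -> light n Y -> light n X.
Proof.
by move=> XY /lightP H; apply/lightP => Z ZX; apply: H; apply: subset_trans XY.
Qed.

Lemma light_leq m n X : m <= n -> light m X -> light n X.
Proof.
move=> mn /lightP H; apply/lightP => Z /H[D domD Dm]; exists D => //.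
exact: leq_trans mn.
Qed.

Lemma light_card X : light #|X| X.
Proof.
apply/lightP => Y YX; exists Y; last exact: subset_leq_card.
by apply/dominates_onP; split=> // y ->.
Qed.

Lemma lightU m n X Y : light m X -> light n Y -> light (m + n) (X :|: Y).
Proof.
move=> /lightP LX /lightP LY; apply/lightP => Z ZXY.
have [D /dominates_onP[DZ domD] Dm] := LX _ (subsetIr Z X).
have [F /dominates_onP[FZ domF] Fn] := LY _ (subsetIr Z Y).
exists (D :|: F); last first.
  by apply: leq_trans (leq_add Dm Fn); rewrite cardsU leq_subr.
apply/dominates_onP; split=> [|y yZ].
  by rewrite subUset (subset_trans DZ (subsetIl _ _)) (subset_trans FZ (subsetIl _ _)).
rewrite inE negb_or => /andP[yD yF].
have := subsetP ZXY y yZ; rewrite inE => /orP[yX|yY].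
  by have [|x xD xy] := domD y _ yD; [rewrite inE yZ | exists x; rewrite ?inE ?xD].
by have [|x xF xy] := domF y _ yF; [rewrite inE yZ | exists x; rewrite ?inE ?xF ?orbT].
Qed.

Lemma light_bigcup (I : finType) (Q : pred I) (F : I -> {set T}) n :
    (forall i, Q i -> light n (F i)) ->
  light (#|Q| * n) (\bigcup_(i | Q i) F i).
Proof.
move=> LF; rewrite -sum_nat_const.
elim/big_rec2: _ => [|i m X Qi LX]; first by rewrite -(@cards0 T) light_card.
exact: lightU (LF i Qi) LX.
Qed.

(** Sort the vertices of [Y] outside [X] by their in-neighbours in [X]. There are at most [2 ^ k]
    classes, so if all were [d]-light then [Y] would be light, the summand [k] paying for the
    vertices of [Y] inside [X]. *)
Lemma heavy_uniform_trace X Y k d :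
    #|X| <= k -> ~~ light (2 ^ k * d + k) Y ->
  exists2 Z : {set T}, Z \subset X & exists C : {set T}, [/\ C \subset Y, ~~ light d C,
    complete Z C & complete C (X :\: Z)].
Proof.
move=> Xk hY.
pose trace y := [set x in X | arc x y].
pose cls Z := [set y in Y :\: X | trace y == Z].
have [/existsP[Z /andP[ZX hZ]]|] :=
  boolP [exists Z : {set T}, (Z \subset X) && ~~ light d (cls Z)].
  exists Z => //; exists (cls Z); split=> //.
  - by apply/subsetP => y; rewrite !inE => /andP[/andP[]].
  - apply/completeP => x y xZ; rewrite inE => /andP[_ /eqP tr_y].
    by move: xZ; rewrite -tr_y inE => /andP[].
  apply/completeP => y x; rewrite inE => /andP[/setDP[_ yX] /eqP <-].
  rewrite !inE negb_and => /andP[+ xX]; rewrite xX /= => nxy.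
  have : x != y by apply: contraNneq yX => <-.
  by move/arc_total; rewrite (negbTE nxy).
rewrite negb_exists => /forallP no_cls; case/negP: hY.
have LX : light k X by apply: light_leq (light_card X).
have LC : light (2 ^ k * d) (\bigcup_(Z | Z \in powerset X) cls Z).
  apply: (@light_leq (#|powerset X| * d)).
    by rewrite card_powerset leq_mul2r leq_exp2l ?Xk ?orbT.
  apply: light_bigcup => Z ZpX; have ZX : Z \subset X by rewrite -powersetE.
  by have := no_cls Z; rewrite ZX negbK.
apply: lightS (lightU LC LX); apply/subsetP => y yY.
rewrite inE; case: (boolP (y \in X)); rewrite ?orbT // => yX.
rewrite orbF; apply/bigcupP; exists (trace y).
  by rewrite inE; apply/subsetP => x; rewrite inE => /andP[].
by rewrite !inE yX yY eqxx.
Qed.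

(** A uniform trace [Z] splits [X] into [Z] and [X :\: Z], and these cannot both be [d]-light when
    [X] is not [(d + d)]-light. *)
Lemma heavy_complete_pair k d X Y :
    #|X| <= k -> ~~ light (d + d) X -> ~~ light (2 ^ k * d + k) Y ->
  exists X' Y' : {set T}, [/\ X' \subset X, Y' \subset Y, ~~ light d X', ~~ light d Y'
                  & complete X' Y' || complete Y' X'].
Proof.
move=> Xk hX hY; have [Z ZX [C [CY hC ZC CX]]] := heavy_uniform_trace Xk hY.
have [LZ|hZ] := boolP (light d Z); last by exists Z, C; split; rewrite ?ZC.
exists (X :\: Z), C; split; rewrite ?CX ?orbT ?subsetDl //.
apply: contra hX => LXZ; apply: lightS (lightU LZ LXZ).
by rewrite -{1}(setID X Z) setSU // subsetIr.
Qed.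

End Light.

(** * From local-to-global to heavy triangles *)

Definition local_to_global :=
  forall c : nat, exists K k : nat, forall (T : tournament) (X : {set T}),
    ~~ light K X -> exists2 Y : {set T}, Y \subset X & #|Y| <= k /\ ~~ light c Y.

Definition beats d (T : tournament) (A B : {set T}) :=
  [exists X : {set T}, exists Y : {set T},
     [&& X \subset A, Y \subset B, ~~ light d X, ~~ light d Y & complete X Y]].

Lemma beatsP d (T : tournament) (A B : {set T}) :
  reflect (exists X Y : {set T}, [/\ X \subset A, Y \subset B, ~~ light d X, ~~ light d Y
                         & complete X Y])
          (beats d A B).
Proof.
apply: (iffP existsP) => -[X].
  by case/existsP => Y /and5P[]; exists X, Y.
by case=> Y []; exists X; apply/existsP; exists Y; apply/and5P.
Qed.

Lemma beats_total : local_to_global -> forall d, exists e, d <= e /\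
  forall (T : tournament) (A B : {set T}),
    ~~ light e A -> ~~ light e B -> beats d A B || beats d B A.
Proof.
move=> lg d; have [K [k lgK]] := lg (d + d).
(* The summand [K] lets [A] be shrunk to at most [k] vertices while staying heavy; the rest is what
   [B] needs for the trace argument. *)
exists (K + (2 ^ k * d + k)); split.
  apply: leq_trans (leq_addl _ _); apply: leq_trans (leq_addr _ _).
  by rewrite leq_pmull // expn_gt0.
move=> T A B hA hB.
have {}hA : ~~ light K A by apply: contra hA; apply: light_leq; apply: leq_addr.
have {}hB : ~~ light (2 ^ k * d + k) B.
  by apply: contra hB; apply: light_leq; apply: leq_addl.
have [A0 A0A [A0k hA0]] := lgK T A hA.
have [X [Y [XA YB hX hY /orP[]]]] := heavy_complete_pair A0k hA0 hB => XY.
  by apply/orP; left; apply/beatsP; exists X, Y; rewrite (subset_trans XA).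
by apply/orP; right; apply/beatsP; exists Y, X; rewrite (subset_trans XA).
Qed.

Definition heavy_triangle h (T : tournament) := exists A B C : {set T},
  [/\ ~~ light h A, ~~ light h B & ~~ light h C] /\
  [/\ complete A B, complete B C & complete C A].

(** A vertex outside [B] either has an in-neighbour in [B] or is complete to [B]. So [B], together
    with a dominating set of the common in-neighbours, dominates [T]. *)
Lemma heavy_common_in_neighbour (T : tournament) (B : {set T}) K :
    (forall D, dominates_on D [set: T] -> K + #|B| < #|D|) ->
  ~~ light K [set v | complete [set v] B].
Proof.
move=> hT; apply/negP => /lightP/(_ _ (subxx _))[D /dominates_onP[DU domD] DK].
have := hT (D :|: B); rewrite ltnNge.
rewrite (leq_trans (leq_card_setU _ _)) ?leq_add2r // => /(_ _)/negP[] //.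
apply/dominates_onP; split=> // y _; rewrite inE negb_or => /andP[yD yB].
have [/exists_inP[b bB byarc]|] := boolP [exists b in B, arc b y].
  by exists b; rewrite // inE bB orbT.
rewrite negb_exists => /forallP noB.
have [|x xD xy] := domD y _ yD; last by exists x; rewrite // inE xD.
rewrite inE; apply/completeP => _ b /set1P-> bB.
have : y != b by apply: contraNneq yB => ->.
by have := noB b; rewrite bB /= => /negbTE nby /arc_total; rewrite nby orbF.
Qed.

Lemma heavy_triangle_exists : local_to_global -> forall h, exists K,
  forall T : tournament,
    (forall D, dominates_on D [set: T] -> K < #|D|) -> heavy_triangle h T.
Proof.
(* Three levels of heaviness: [c] for the family [E], [d] for the corners of the 4-cycle, [h] for
   the triangle. *)
move=> lg h; have [d [hd tot_h]] := beats_total lg h.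
have [c [_ tot_d]] := beats_total lg d.
have [K [k lgK]] := lg c; exists (K + k) => T hT.
have up (B : {set T}) : #|B| <= k ->
    exists S : {set T}, [&& complete S B, #|S| <= k & ~~ light c S].
  move=> Bk; have hU : ~~ light K [set v | complete [set v] B].
    apply: heavy_common_in_neighbour => D /hT; apply: leq_ltn_trans.
    by rewrite leq_add2l.
  have [S /subsetP SU [Sk hS]] := lgK _ _ hU.
  exists S; rewrite Sk hS !andbT; apply/completeP => s b sS bB.
  by have := SU s sS; rewrite inE => /completeP; apply; rewrite ?set11.
(* The default [set0] is never taken when [#|B| <= k]. *)
pose s (B : {set T}) :=
  odflt set0 [pick S : {set T} | [&& complete S B, #|S| <= k & ~~ light c S]].
have sP (B : {set T}) : #|B| <= k ->
    [&& complete (s B) B, #|s B| <= k & ~~ light c (s B)].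
  move=> /up[S SP]; rewrite /s; case: pickP => [//|/(_ S)].
  by rewrite SP.
pose E := [set A : {set T} | (#|A| <= k) && ~~ light c A].
have [|[A [B [AE BE /andP[]]]]] :
    {in E &, forall A B, ~~ (beats d A (s B) && beats d B (s A))} \/
    exists A B, [/\ A \in E, B \in E & beats d A (s B) && beats d B (s A)].
- have [H|] := boolP [forall A in E, forall B in E,
      ~~ (beats d A (s B) && beats d B (s A))].
    left=> A B AE BE; exact: (forall_inP (forall_inP H A AE) B BE).
  case/forall_inPn => A AE /forall_inPn[B BE]; rewrite negbK => AB.
  by right; exists A, B.
(* The family [E] is nonempty: the empty set is small enough for [s] to return a heavy set. *)
- move=> Eshift; have : s set0 \in E.
    have k0 : #|set0 : {set T}| <= k by rewrite cards0.
    by rewrite inE; have /and3P[_ -> ->] := sP _ k0.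
  rewrite (total_shift_empty _ _ Eshift) ?inE // => [A|A B].
    by rewrite inE => /andP[Ak _]; rewrite inE; have /and3P[_ -> ->] := sP A Ak.
  by rewrite !inE => /andP[_ hA] /andP[_ hB]; apply: tot_d.
move=> /beatsP[X [Y [XA YsB hX hY XY]]] /beatsP[X' [Y' [X'B Y'sA hX' hY' X'Y']]].
have YX' : complete Y X'.
  by move: BE; rewrite inE => /andP[/sP/and3P[/(completeS YsB X'B)]].
have Y'X : complete Y' X.
  by move: AE; rewrite inE => /andP[/sP/and3P[/(completeS Y'sA XA)]].
have wk (Z : {set T}) : ~~ light d Z -> ~~ light h Z.
  by apply: contra; apply: light_leq.
(* In the 4-cycle [X => Y => X' => Y' => X], a chord from [X] to [X'] closes up through [Y'], and
   one from [X'] to [X] through [Y]. *)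
have /orP[] := tot_h T X X' hX hX' => /beatsP[U [V [UX VX hU hV UV]]].
  exists U, V, Y'; split; first by split=> //; apply: wk.
  by split=> //; [apply: completeS X'Y' | apply: completeS Y'X].
exists U, V, Y; split; first by split=> //; apply: wk.
by split=> //; [apply: completeS XY | apply: completeS YX'].
Qed.

(** * Domination numbers of induced subtournaments, read in the ambient tournament *)

Lemma domination_numberP (T : tournament) n :
  reflect (exists2 D : {set T}, dominates_on D [set: T] & #|D| <= n)
          (domination_number T <= n).
Proof.
have domE (D : {set T}) : dominates_on D [set: T] = dominating D.
  by rewrite /dominates_on subsetT setTD.
rewrite /domination_number.
case: arg_minnP => [|M domM minM]; first exact: dominatingT.
apply: (iffP idP) => [Mn|[D]]; first by exists M; rewrite ?domE.
by rewrite domE => /minM; apply: leq_trans.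
Qed.

Lemma dominates_on_val (T : tournament) (X : {set T}) (D A : {set induced X}) :
  dominates_on D A -> dominates_on (val @: D) (val @: A).
Proof.
case/dominates_onP => DA domD; apply/dominates_onP; split; first exact: imsetS.
move=> _ /imsetP[y yA ->]; rewrite (mem_imset _ _ val_inj) => yD.
by have [x xD xy] := domD y yA yD; exists (val x); first exact: imset_f.
Qed.

Lemma domination_number_inducedP (T : tournament) (X : {set T}) n :
  reflect (exists2 D, dominates_on D X & #|D| <= n)
          (domination_number (induced X) <= n).
Proof.
have valT : val @: [set: induced X] = X.
  apply/setP => x; apply/imsetP/idP => [[y _ ->]|xX]; first exact: (valP y).
  by exists (Sub x xX : induced X); rewrite ?inE.
apply: (iffP (domination_numberP _ _)) => -[D domD Dn].
  exists (val @: D); first by have := dominates_on_val domD; rewrite valT.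
  exact: leq_trans (leq_imset_card _ _) Dn.
have [/subsetP DX domDX] := dominates_onP _ _ domD.
exists [set y : induced X | val y \in D].
  apply/dominates_onP; split; first exact: subsetT.
  move=> y _; rewrite inE => yD; have [x xD xy] := domDX _ (valP y) yD.
  by exists (Sub x (DX x xD) : induced X); rewrite ?inE.
rewrite -(card_imset _ val_inj); apply: leq_trans Dn; apply: subset_leq_card.
by apply/subsetP => _ /imsetP[y + ->]; rewrite inE.
Qed.

(** A set that is not [K]-light has a subset [Y] inducing domination number above [K]. The
    hypothesis applied to [induced Y] gives a small set, which [val] carries back to [T]. *)
Lemma local_to_global_light :
  (forall c : nat, exists K k : nat, 1 <= K /\ 1 <= k /\
     forall T : tournament, K <= domination_number T ->
       exists A : {set T}, #|A| <= k /\ c <= domination_number (induced A)) ->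
  local_to_global.
Proof.
(* The successor is taken because not being [c]-light asks for strictly more than [c] dominating
   vertices. *)
move=> lg c; have [K [k [_ [_ lgK]]]] := lg c.+1.
exists K, k => T X /heavyP[Y YX hY].
have [|A [Ak hA]] := lgK (induced Y).
  apply: contraT; rewrite -ltnNge => /ltnW.
  by case/domination_number_inducedP => D /hY; rewrite ltnNge => /negbTE->.
exists (val @: A).
  apply/subsetP => _ /imsetP[y _ ->]; exact: (subsetP YX _ (valP y)).
rewrite card_imset; last exact: val_inj.
split=> //; apply/heavyP; exists (val @: A) => // D domD; rewrite ltnNge.
apply: contraL hA => Dc; rewrite -ltnNge ltnS.
apply/domination_number_inducedP.
have [/subsetP DA domDA] := dominates_onP _ _ domD.
exists [set y : induced Y | val y \in D].
  apply/dominates_onP; split.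
    apply/subsetP => y; rewrite inE => /DA.
    by rewrite (mem_imset _ _ val_inj).
  move=> y yA; rewrite inE => yD.
  have [x xD xy] := domDA _ (imset_f val yA) yD.
  have /imsetP[z zA xz] := DA x xD.
  by exists z; rewrite ?inE -?xz // /induced_arc /= /arc /= /induced_arc -xz.
rewrite -(card_imset _ val_inj); apply: leq_trans Dc; apply: subset_leq_card.
by apply/subsetP => _ /imsetP[y + ->]; rewrite inE.
Qed.

(** * Embeddings and the induction on [t] *)

Definition embeds (H T : tournament) (X : {set T}) :=
  [exists f : {ffun H -> T},
     [forall x, f x \in X] && [forall x, forall y, arc (f x) (f y) == arc x y]].

Lemma embedsP (H T : tournament) (X : {set T}) :
  reflect (exists f : H -> T,
             (forall x, f x \in X) /\ (forall x y, arc (f x) (f y) = arc x y))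
          (embeds H X).
Proof.
apply: (iffP existsP) => -[f].
  case/andP => /forallP fX /forallP farc; exists f; split=> // x y.
  by have /forallP/(_ y)/eqP := farc x.
case=> fX farc; exists (finfun f); apply/andP; split; apply/forallP => x.
  by rewrite ffunE.
by apply/forallP => y; rewrite !ffunE farc.
Qed.

(** Distinct vertices are joined by an arc, which would become a loop if they had the same image. *)
Lemma arc_morphism_inj (H T : tournament) (f : H -> T) :
  (forall x y, arc (f x) (f y) = arc x y) -> injective f.
Proof.
move=> farc x y eq_f; apply/eqP; apply: contraT => /arc_total.
by rewrite -!farc eq_f arc_irr.
Qed.

Lemma freeP (H T : tournament) : free H T <-> ~~ embeds H [set: T].
Proof.
split=> [freeT|nemb A [f [[g fK gK] farc]]].
  apply/negP => /embedsP[f [_ farc]]; have f_inj := arc_morphism_inj farc.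
  pose A := f @: [set: H].
  have fA x : f x \in A by apply: imset_f; rewrite inE.
  pose g (x : H) : induced A := Sub (f x) (fA x).
  have g_inj : injective g by move=> x y /(congr1 val)/f_inj.
  have [g' gK g'K] : bijective g.
    apply: (inj_card_bij g_inj).
    by rewrite card_sig -cardsT -(card_imset _ f_inj) (eq_card (B := mem A)).
  apply: (freeT A); exists g'; split; first by exists g.
  by move=> x y; rewrite -{2}[x]g'K -{2}[y]g'K [RHS]farc.
case/negP: nemb; apply/embedsP; exists (fun x => val (g x)); split.
  by move=> x; rewrite inE.
by move=> x y; rewrite -{2}[x]gK -{2}[y]gK farc.
Qed.

(** Heaviness supplies a subset whose induced domination number exceeds [h], so that subtournament
    cannot be [H]-free. *)
Lemma heavy_embeds (H : tournament) h :
    (forall T : tournament, free H T -> domination_number T <= h) ->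
  forall (T : tournament) (X : {set T}), ~~ light h X -> embeds H X.
Proof.
move=> freeH T X /heavyP[Y YX hY].
have : embeds H [set: induced Y].
  apply: contraT => /freeP/freeH/domination_number_inducedP[D /hY].
  by rewrite ltnNge => /negbTE->.
case/embedsP => f [_ farc]; apply/embedsP; exists (fun x => val (f x)); split.
  by move=> x; apply: (subsetP YX); apply: (valP (f x)).
by move=> x y; rewrite -farc.
Qed.

Lemma Delta_embeds (H1 H2 H3 T : tournament) (A B C : {set T}) :
    embeds H1 A -> embeds H2 B -> embeds H3 C ->
    complete A B -> complete B C -> complete C A ->
  embeds (Delta H1 H2 H3) [set: T].
Proof.
move=> /embedsP[f [fA farc]] /embedsP[g [gB garc]] /embedsP[k [kC karc]].
move=> /completeP AB /completeP BC /completeP CA; apply/embedsP.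
exists (fun u : Delta H1 H2 H3 =>
  match u with inl (inl x) => f x | inl (inr x) => g x | inr x => k x end).
split=> [x|]; first by rewrite inE.
move=> [[x|x]|x] [[y|y]|y]; rewrite ?farc ?garc ?karc //=.
- exact: AB.
- by apply: arc_asym; apply: CA.
- by apply: arc_asym; apply: AB.
- exact: BC.
- exact: CA.
- by apply: arc_asym; apply: BC.
Qed.

Theorem mainTheorem6 :
  (forall c : nat, exists K k : nat, 1 <= K /\ 1 <= k /\
     forall T : tournament, K <= domination_number T ->
       exists A : {set T}, #|A| <= k /\ c <= domination_number (induced A)) ->
  forall t : nat, 1 <= t ->
    exists K : nat, forall T : tournament,
      free (calT t) T -> domination_number T <= K.
Proof.
move=> /local_to_global_light lg; elim=> [//|[|t] IH] _.
  (* A tournament without a one-vertex subtournament is empty, so [set0] dominates it. *)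
  exists 0 => T /freeP nemb; apply/domination_numberP; exists set0;
    last by rewrite cards0.
  apply/dominates_onP; split=> [|x _ _]; first exact: sub0set.
  case/negP: nemb; apply/embedsP; exists (fun _ => x); split=> [y|y z].
    by rewrite inE.
  by rewrite arc_irr.
have [//|h freeh] := IH.
(* With [h] the bound for [calT t.+1], each corner of an [h]-heavy triangle contains a copy of
   [calT t.+1], and the three copies form [calT t.+2]. *)
have [K HK] := heavy_triangle_exists lg h; exists K => T /freeP nemb.
apply: contraT => hT; case/negP: nemb.
have [|A [B [C [[hA hB hC] [AB BC CA]]]]] := HK T.
  move=> D domD; rewrite ltnNge; apply: contra hT => DK.
  by apply/domination_numberP; exists D.
by apply: (@Delta_embeds _ _ _ _ A B C) => //; apply: (heavy_embeds freeh).
Qed.
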